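(* As $n\to\infty$, the threshold bias for the Maker-Breaker odd cycle game satisfies $$b_{mb}(\mathcal{OC}_n) \;\geq\; \left(\frac{4-\sqrt 6}{5} - o(1)\right) n .$$
   Context: $K_n$ is the complete graph on the vertex set $[n]=\{1,\dots,n\}$, and $\mathcal{OC}_n=\{E(C) : C \text{ an odd cycle in } K_n\}$. Biased Maker-Breaker game with bias $b$ and winning sets $\mathcal F\subset 2^{E(K_n)}$: the two players, Maker and Breaker, alternately claim previously unclaimed edges of $K_n$ (the board is $E(K_n)$), with perfect information. Maker moves first and claims $1$ edge per turn. Breaker claims $b$ edges per turn (all remaining edges if fewer than $b$ are left). The game goes on until all edges are claimed. Maker wins if she succeeds in claiming all edges of some $F\in\mathcal F$, and Breaker wins otherwise. If Breaker has a winning strategy for some bias $b$, he also has one for every $b'\ge b$. The threshold bias $b_{mb}(\mathcal F)$ is the integer such that Breaker has a winning strategy in the game with bias $b$ if and only if $b\ge b_{mb}(\mathcal F)$. *)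

(* Defs.v *)
From mathcomp Require Import all_boot all_order all_algebra.
From mathcomp Require Import all_classical all_reals all_analysis.

Set Implicit Arguments.
Unset Strict Implicit.
Unset Printing Implicit Defensive.

Section BiasedMakerBreaker.

Variables (T : finType) (board : {set T}).

(* A round (e, R) consists of Maker claiming e, then Breaker claiming all of R;
   histories list the completed rounds, most recent first. *)
Definition history := seq (T * {set T}).

Definition maker_claimed (h : history) : {set T} :=
  \bigcup_(r <- h) [set r.1]%SET.

Definition breaker_claimed (h : history) : {set T} :=
  \bigcup_(r <- h) r.2.

Definition unclaimed (h : history) : {set T} :=
  board :\: (maker_claimed h :|: breaker_claimed h).

(* sigma h e is Breaker's answer when Maker claims e after the rounds h. *)
Definition breaker_strategy := history -> T -> {set T}.

Definition legal_answer (b : nat) (free R : {set T}) : Prop :=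
  R \subset free /\ #|R| = minn b #|free|.

Inductive consistent_play (sigma : breaker_strategy) : history -> Prop :=
| consistent_nil : consistent_play sigma [::]
| consistent_cons h e :
    consistent_play sigma h -> e \in unclaimed h ->
    consistent_play sigma ((e, sigma h e) :: h).

Definition breaker_winning_strategy (F : {set T} -> Prop) (b : nat)
    (sigma : breaker_strategy) : Prop :=
  (forall h e, consistent_play sigma h -> e \in unclaimed h ->
     legal_answer b (unclaimed h :\ e) (sigma h e)) /\
  (forall h, consistent_play sigma h -> unclaimed h = finset.set0 ->
     forall A, F A -> ~~ (A \subset maker_claimed h)).

Definition breaker_wins (F : {set T} -> Prop) (b : nat) : Prop :=
  exists sigma : breaker_strategy, breaker_winning_strategy F b sigma.

Definition is_threshold_bias (F : {set T} -> Prop) (t : nat) : Prop :=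
  forall b : nat, breaker_wins F b <-> (t <= b)%N.

(* At most one t satisfies is_threshold_bias; the value is 0 if there is none,
   so a positive lower bound on it entails that the threshold exists. *)
Definition threshold_bias (F : {set T} -> Prop) : nat :=
  xget 0%N (is_threshold_bias F).

End BiasedMakerBreaker.

Definition complete_graph_edges (n : nat) : {set {set 'I_n}} :=
  [set e : {set 'I_n} | #|e| == 2]%SET.

Definition cycle_edges (n : nat) (c : seq 'I_n) : {set {set 'I_n}} :=
  [set [set x; next c x] | x in c]%SET.

Definition odd_cycle (n : nat) (A : {set {set 'I_n}}) : Prop :=
  exists c : seq 'I_n,
    [/\ uniq c, (3 <= size c)%N, odd (size c) & A = cycle_edges c].

Definition b_mb_odd_cycle (n : nat) : nat :=
  threshold_bias (complete_graph_edges n) (@odd_cycle n).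

(* Main.v *)
Require Import Defs.
From Stdlib Require Import ZArith Lia.
From mathcomp Require Import all_boot all_order all_algebra zify lra.
From mathcomp Require boolp classical_sets.

(** Maker wins with bias b = 9n/29 as soon as n >= 2000.  Since 9/29 exceeds
    (4 - sqrt 6)/5 = 0.3101..., the error term delta may be taken to be 0 for
    all those n.

    Maker keeps her edges a tree with colour classes X and Y of sizes x and y.
    An edge inside a class would close an odd cycle, so after each of his turns
    Breaker must own every edge inside X and inside Y ([tree_clique]).  If some
    edge from an outer vertex v to X is free, Maker threatens to put v into Y,
    after which Breaker has a single turn to claim all edges from v to Y;
    hence he already owns at least y - b of them ([tree_deg]).

    Breaker owns at most b(x + y - 1) edges.  These include all edges inside
    X and inside Y, some edges between X and Y, which do him no good, and at
    each outer vertex v the edges towards X and Y.  The strategy keeps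
    x <= y <= x + b, makes Breaker waste at least x(x-1)/2 edges between X and
    Y, and ensures about x Breaker edges from each outer vertex to the tree.
    These properties make up [rest_state].

    An outer vertex is full to a class if Breaker owns all its edges to it.
    - If an outer v is full to neither class, Maker attaches it to Y when
      y < x + b ([rest_step_Y]).  When y = x + b she attaches it to X, where
      its y - b = x or more edges to Y become waste ([rest_step_X]).
    - If every outer vertex is full to X or to Y, let Z1 be the outer vertices
      that are not full to Y.  Maker picks v in Z1 with more than b free edges
      into Z1 and attaches it to X.  One turn does not suffice for Breaker to
      spoil all these free edges, so the other end u of one of them can be put
      into Y through v, and its x edges to the old X become waste
      ([rest_step_XY]).
    - Such a v exists while x <= n/6: otherwise Breaker owns at least
      |Z1|(|Z1| - 1 - b)/2 edges inside Z1, too many in addition to the others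
      ([rest_not_stuck]).

    The tree grows with each step and x by at most one, so x reaches n/6; there
    the edges listed above outnumber those Breaker can own ([rest_final]).  In
    units of n, with x = 1/6 and y = x + t, this is the inequality
    -x^2 + 2(1 - 2b)x + t^2 - 2bt > 0 for 0 <= t <= b, which holds for
    b = 9/29.

    As for the rules of the game, a winning strategy of Breaker is traded for a
    family of positions that he can maintain ([breaker_winsP]).  In this form
    a larger bias visibly does not hurt Breaker, so the threshold exists, and
    Maker's strategy becomes an induction over positions of such a family. *)

Set Implicit Arguments.
Unset Strict Implicit.
Unset Printing Implicit Defensive.

(** * Winning positions and monotonicity in the bias *)

Section Game.

Variables (T : finType) (board : {set T}) (F : {set T} -> Prop).
Implicit Types (A B M R free : {set T}) (b : nat) (h : history T).

(** [P M B] holds on a family of positions (M, B), with Maker to move, which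
    contains the initial one, in which Maker has claimed no winning set, and
    in which Breaker can remain whatever Maker claims. *)
Record breaker_safe b (P : {set T} -> {set T} -> Prop) : Prop := BreakerSafe {
  safe_start : P set0 set0;
  safe_avoids : forall M B A, P M B -> F A -> ~~ (A \subset M);
  safe_reply : forall M B e, P M B -> e \in board :\: (M :|: B) ->
    exists2 R, legal_answer b (board :\: (M :|: B) :\ e) R &
               P (e |: M) (R :|: B) }.

Lemma maker_claimed_cons r h :
  maker_claimed (r :: h) = r.1 |: maker_claimed h.
Proof. by rewrite /maker_claimed big_cons. Qed.

Lemma breaker_claimed_cons r h :
  breaker_claimed (r :: h) = r.2 :|: breaker_claimed h.
Proof. by rewrite /breaker_claimed big_cons. Qed.

Lemma unclaimed_cons r h :
  unclaimed board (r :: h) = unclaimed board h :\: (r.1 |: r.2).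
Proof.
apply/setP=> x; rewrite /unclaimed maker_claimed_cons breaker_claimed_cons !inE.
by do !case: (_ \in _); case: (x == _).
Qed.

(** A winning strategy protects Breaker in the middle of a play as well, since
    every play extends to a complete one. *)
Lemma winning_strategy_avoids b (sigma : breaker_strategy T) h A :
  breaker_winning_strategy board F b sigma -> consistent_play board sigma h ->
  F A -> ~~ (A \subset maker_claimed h).
Proof.
move=> [_ win]; have [n] := ubnP #|unclaimed board h|.
elim: n h => // n IHn h le_n play FA.
have [free0|[e eh]] := set_0Vmem (unclaimed board h); first exact: win.
apply: contra (IHn ((e, sigma h e) :: h) _ (consistent_cons play eh) FA).
  by move/subset_trans; apply; rewrite maker_claimed_cons subsetUr.
rewrite -ltnS; apply: leq_trans le_n; rewrite ltnS; apply: proper_card.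
rewrite unclaimed_cons properE subsetDl /=; apply/negP => /subsetP/(_ e eh).
by rewrite !inE eqxx.
Qed.

Lemma breaker_winsP b :
  breaker_wins board F b <-> exists P, breaker_safe b P.
Proof.
split=> [[sigma win]|[P safeP]].
  exists (fun M B => exists h, [/\ consistent_play board sigma h,
    M = maker_claimed h & B = breaker_claimed h]); split.
  - exists [::]; split; [exact: consistent_nil| |];
      by rewrite /maker_claimed /breaker_claimed big_nil.
  - by move=> _ _ A [h [play -> _]]; apply: winning_strategy_avoids win play.
  move=> _ _ e [h [play -> ->]] eh; exists (sigma h e); first exact: win.1.
  exists ((e, sigma h e) :: h); split; first exact: consistent_cons.
    by rewrite maker_claimed_cons.
  by rewrite breaker_claimed_cons.
pose good h e R :=
  legal_answer b (unclaimed board h :\ e) R /\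
  P (e |: maker_claimed h) (R :|: breaker_claimed h).
pose sigma h e := classical_sets.xget set0 (good h e).
have inv h : consistent_play board sigma h ->
    P (maker_claimed h) (breaker_claimed h).
  elim=> {h} [|h e play IHh eh].
    by rewrite /maker_claimed /breaker_claimed !big_nil; case: safeP.
  have [R legalR PR] := safe_reply safeP IHh eh.
  rewrite maker_claimed_cons breaker_claimed_cons /=.
  by have [] := classical_sets.xgetPex set0 (ex_intro (good h e) R (conj legalR PR)).
exists sigma; split=> [h e play eh|h play _ A]; last first.
  exact/(safe_avoids safeP)/inv.
have [R legalR PR] := safe_reply safeP (inv h play) eh.
by have [] := classical_sets.xgetPex set0 (ex_intro (good h e) R (conj legalR PR)).
Qed.

Lemma subset_of_card k A B :
  A \subset B -> #|A| <= k <= #|B| ->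
  exists R, [/\ A \subset R, R \subset B & #|R| = k].
Proof.
move=> sAB /andP[leAk]; elim: k leAk => [|k IHk].
  by rewrite leqn0 => /eqP A0 _; exists A.
rewrite leq_eqVlt => /predU1P[<- _|ltAk ltkB]; first by exists A.
have [R [sAR sRB cardR]] := IHk ltAk (ltnW ltkB).
have [x] : exists x, x \in B :\: R.
  apply/set0Pn; rewrite setD_eq0; apply/negP => /subset_leq_card.
  by rewrite cardR leqNgt ltkB.
rewrite inE => /andP[xR xB]; exists (x |: R); split.
- exact: subset_trans sAR (subsetUr _ _).
- by rewrite subUset sub1set xB.
by rewrite cardsU1 xR cardR.
Qed.

(** With a larger bias Breaker plays as if some of his edges were not his: the
    family consists of the positions (M, B) such that (M, B0) is safe for the
    smaller bias, for some subset B0 of B. *)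
Lemma breaker_wins_mono b b' :
  b <= b' -> breaker_wins board F b -> breaker_wins board F b'.
Proof.
move=> lebb' /breaker_winsP[P safeP]; apply/breaker_winsP.
exists (fun M B => exists2 B0 : {set T}, B0 \subset B & P M B0); split.
- by exists set0; [exact: sub0set|case: safeP].
- by move=> M B A [B0 _ PMB0]; apply: (safe_avoids safeP PMB0).
move=> M B e [B0 sB0B PMB0] efree.
have efree0 : e \in board :\: (M :|: B0).
  by apply: subsetP efree; rewrite setDS // setUS.
have [R0 [sR0 cardR0] PR0] := safe_reply safeP PMB0 efree0.
set free := board :\: (M :|: B) :\ e.
have [||R [sR0R sRfree cardR]] := @subset_of_card (minn b' #|free|) (R0 :&: free) free.
- exact: subsetIr.
- rewrite geq_minr leq_min (subset_leq_card (subsetIr _ _)) !andbT.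
  apply: leq_trans (subset_leq_card (subsetIl _ _)) _.
  by rewrite cardR0 (leq_trans (geq_minl _ _)).
exists R => //; exists (R0 :|: B0) => //.
rewrite subUset (subset_trans sB0B (subsetUr _ _)) andbT.
apply/subsetP=> x xR0; rewrite inE orbC; case: (boolP (x \in B)) => //= xB.
apply: (subsetP sR0R); rewrite inE xR0 /=.
have := subsetP sR0 x xR0; rewrite /free !inE (negPf xB) orbF.
by case/and3P=> -> /norP[-> _] ->.
Qed.

(** Breaker claims the whole rest of the board in his first turn. *)
Lemma breaker_wins_large :
  (forall A, F A -> 1 < #|A|) -> breaker_wins board F #|board|.
Proof.
move=> F_gt1; apply/breaker_winsP.
exists (fun M B => #|M| <= 1 /\ (M = set0 \/ board \subset M :|: B)); split.
- by rewrite cards0; split=> //; left.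
- move=> M B A [M1 _] /F_gt1 A1; apply: contraL A1 => /subset_leq_card sAM.
  by rewrite -leqNgt (leq_trans sAM).
move=> M B e [_ [->|sboard]]; last first.
  by rewrite inE => /andP[/negP eMB /(subsetP sboard)].
move=> efree; set free := _ :\ e; exists free; first split=> //.
  apply/esym/minn_idPr/subset_leq_card.
  rewrite /free -setDDl; apply: subset_trans (subsetDl _ _) _.
  exact: subset_trans (subsetDl _ _) (subsetDl _ _).
rewrite setU0 cards1; split=> //; right; apply/subsetP=> x xb.
by rewrite !inE xb; case: (x == e); case: (x \in B).
Qed.

Lemma lt_threshold_bias b :
  (forall A, F A -> 1 < #|A|) -> ~ breaker_wins board F b ->
  b < threshold_bias board F.
Proof.
move=> F_gt1 lose.
have exwin : exists c, boolp.asbool (breaker_wins board F c).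
  by exists #|board|; apply/boolp.asboolP/breaker_wins_large.
have thr : is_threshold_bias board F (ex_minn exwin).
  case: ex_minnP => t /boolp.asboolP wint mint c; split.
    by move/boolp.asboolP; apply: mint.
  by move=> le_tc; apply: breaker_wins_mono wint.
rewrite ltnNge; apply/negP.
by move=> /(classical_sets.xgetPex 0%N (ex_intro _ _ thr) b) /lose.
Qed.

End Game.

(** * Counting the edges of Breaker *)

Section Counting.

Variable V : finType.
Implicit Types (B R : {set {set V}}) (A C X Y : {set V}) (u v w : V).

(** The number of edges of [B] from [v] to [A]. *)
Definition deg B v A : nat := #|[set u in A | [set v; u] \in B]|.

(** The number of pairs in [A] times [C] joined by an edge of [B]; edges with
    both ends in the intersection of [A] and [C] count twice. *)
Definition cross B A C : nat := \sum_(u in A) deg B u C.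

Lemma set2_inj v : injective (fun u => [set v; u]).
Proof.
move=> u w /= eq_uw.
have : u \in [set v; w] by rewrite -eq_uw set22.
have : w \in [set v; u] by rewrite eq_uw set22.
by rewrite !inE => /orP[/eqP->|/eqP->] // /orP[] /eqP.
Qed.

Lemma degE B v A : deg B v A = \sum_(u in A) ([set v; u] \in B).
Proof.
rewrite /deg -sum1_card big_mkcond [RHS]big_mkcond /=; apply: eq_bigr => u _.
by rewrite inE; case: (u \in A); case: (_ \in B).
Qed.

Lemma deg_le_card B v A : deg B v A <= #|B|.
Proof.
rewrite /deg -(card_imset _ (@set2_inj v)); apply: subset_leq_card.
by apply/subsetP=> e /imsetP[u]; rewrite inE => /andP[_ uB] ->.
Qed.

Lemma degS B B' v A A' :
  B \subset B' -> A \subset A' -> deg B v A <= deg B' v A'.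
Proof.
move=> sB sA; apply: subset_leq_card; apply/subsetP=> u; rewrite !inE.
by case/andP=> /(subsetP sA)-> /(subsetP sB)->.
Qed.

Lemma deg_full B v A :
  {in A, forall u, [set v; u] \in B} -> deg B v A = #|A|.
Proof.
move=> full; congr #|pred_of_set _|; apply/setP=> u; rewrite inE.
by apply: andb_idr; apply: full.
Qed.

Lemma degUl B R v A : deg (R :|: B) v A <= deg R v A + deg B v A.
Proof.
rewrite !degE -big_split; apply: leq_sum => u _ /=.
by rewrite inE; case: (_ \in R); case: (_ \in B).
Qed.

Lemma crossC B A C : cross B A C = cross B C A.
Proof.
rewrite /cross (eq_bigr (fun u => \sum_(v in C) ([set u; v] \in B))); last first.
  by move=> u _; rewrite degE.
rewrite exchange_big; apply: eq_bigr => v _; rewrite degE.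
by apply: eq_bigr => u _; rewrite setUC.
Qed.

Lemma crossS B B' A C C' :
  B \subset B' -> C \subset C' -> cross B A C <= cross B' A C'.
Proof. by move=> sB sC; apply: leq_sum => u _; apply: degS. Qed.

Lemma crossU1l B v A C : v \notin A ->
  cross B (v |: A) C = deg B v C + cross B A C.
Proof. by move=> vA; rewrite /cross big_setU1. Qed.

Lemma crossU1r B v A C : v \notin C ->
  cross B A (v |: C) = deg B v A + cross B A C.
Proof. by move=> vC; rewrite crossC crossU1l // [cross B C A]crossC. Qed.

Lemma handshake B :
  {in B, forall e : {set V}, #|e| = 2} -> cross B setT setT <= #|B|.*2.
Proof.
move=> card2; rewrite -muln2 -sum_nat_const.
rewrite (eq_bigr (fun e : {set V} => \sum_(v in e) 1)); last first.
  by move=> e eB; rewrite sum1_card card2.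
rewrite (exchange_big_dep xpredT) //= /cross [leqLHS](eq_bigl xpredT); last first.
  by move=> v; rewrite inE.
apply: leq_sum => v _.
rewrite sum1_card /deg -(card_imset _ (@set2_inj v)); apply: subset_leq_card.
apply/subsetP=> e /imsetP[u]; rewrite inE => /andP[_ uB] ->.
by rewrite unfold_in uB set21.
Qed.

Lemma sum_split X Y (f : V -> nat) : [disjoint X & Y] ->
  \sum_v f v = \sum_(v in X) f v + \sum_(v in Y) f v + \sum_(v in ~: (X :|: Y)) f v.
Proof.
move=> disjXY; rewrite (bigID (mem (X :|: Y))) /= -(bigU (mem X) (mem Y) f disjXY).
by congr (_ + _); apply: eq_bigl => v; rewrite !inE.
Qed.

Lemma card_sides X Y : [disjoint X & Y] ->
  #|X| + #|Y| + #|~: (X :|: Y)| = #|V|.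
Proof. by move=> disjXY; rewrite -!sum1_card -sum_split. Qed.

Lemma deg_split B v X Y : [disjoint X & Y] ->
  deg B v setT = deg B v X + deg B v Y + deg B v (~: (X :|: Y)).
Proof.
move=> disjXY; rewrite !degE -sum_split //.
by apply: eq_bigl => u; rewrite inE.
Qed.

Lemma cross_clique B X :
  {in X &, forall u v, u != v -> [set u; v] \in B} ->
  #|X| * #|X| <= cross B X X + #|X|.
Proof.
move=> clique; rewrite -[leqRHS]addn0 -{3}sum1_card -big_split /= addn0.
rewrite -sum_nat_const; apply: leq_sum => u uX; rewrite addn1 (cardsD1 u) uX.
rewrite ltnS; apply: subset_leq_card; apply/subsetP=> v.
by rewrite !inE => /andP[vu vX]; rewrite vX clique // eq_sym.
Qed.

(** The edges of [B] inside [X], inside [Y], between [X] and [Y], from the outer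
    vertices to [X] and [Y], and between outer vertices, all counted twice. *)
Lemma card_lower_bound B X Y (Z := ~: (X :|: Y)) :
  {in B, forall e : {set V}, #|e| = 2} -> [disjoint X & Y] ->
  {in X &, forall u v, u != v -> [set u; v] \in B} ->
  {in Y &, forall u v, u != v -> [set u; v] \in B} ->
  #|X| * #|X| + #|Y| * #|Y| + (cross B X Y).*2
    + (\sum_(v in Z) (deg B v X + deg B v Y)).*2 + cross B Z Z
  <= #|B|.*2 + #|X| + #|Y|.
Proof.
move=> card2 disjXY cliqueX cliqueY.
have split A : cross B A setT = cross B A X + cross B A Y + cross B A Z.
  rewrite /cross (eq_bigr _ (fun u _ => deg_split B u disjXY)).
  by rewrite !big_split.
have splitT : cross B setT setT = cross B X setT + cross B Y setT + cross B Z setT.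
  by rewrite /cross -sum_split //; apply: eq_bigl => u; rewrite inE.
have := handshake card2; have := cross_clique cliqueX.
have := cross_clique cliqueY; rewrite splitT !split big_split /=.
rewrite -/(cross B Z X) -/(cross B Z Y) (crossC B Y X) (crossC B X Z).
rewrite (crossC B Y Z); lia.
Qed.

(** An edge [e] of [B] is charged to its only end in [A]. *)
Lemma cross_le_card B A C : [disjoint A & C] -> cross B A C <= #|B|.
Proof.
move=> disjAC.
pose joins (e : {set V}) u := (u \in e) && (e :\ u \subset C).
apply: (@leq_trans (\sum_(u in A) \sum_(e in B | joins e u) 1)).
  apply: leq_sum => u uA.
  rewrite sum1_card /deg -(card_imset _ (@set2_inj u)); apply: subset_leq_card.
  apply/subsetP=> e /imsetP[w]; rewrite inE => /andP[wC uwB] ->.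
  rewrite unfold_in uwB /joins set21; apply/subsetP=> z; rewrite !inE.
  by case/andP=> /negPf-> /eqP->.
rewrite (exchange_big_dep (mem B)) /= => [|u e _ /andP[] //].
rewrite -sum1_card; apply: leq_sum => e eB; rewrite sum1_card.
apply/card_le1_eqP => u w; rewrite !unfold_in => /and3P[uA _ /andP[ue sub_u]].
case/and3P=> wA _ /andP[we _]; apply/eqP; apply: contraTT (wA : w \in A) => neq_uw.
rewrite (disjointFl disjAC) //; apply: (subsetP sub_u).
by rewrite !inE we neq_uw.
Qed.

(** All edges from [v] to [A] belong to [B]. *)
Definition full B v A := [forall u in A, [set v; u] \in B].

Lemma fullPn B v A :
  reflect (exists2 u, u \in A & [set v; u] \notin B) (~~ full B v A).
Proof.
apply: (iffP forallPn) => [[u]|[u uA uB]].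
  by rewrite negb_imply => /andP[uA uB]; exists u.
by exists u; rewrite negb_imply uA.
Qed.

Lemma deg_of_full B v A : full B v A -> deg B v A = #|A|.
Proof. by move/forall_inP => fullA; apply: deg_full. Qed.

Lemma untouched_vertex R A C : [disjoint A & C] -> #|R| < #|A| ->
  exists2 u, u \in A & {in C, forall w, [set u; w] \notin R}.
Proof.
move=> disjAC ltRA.
suff /exists_inP[u uA] : [exists u in A, [forall w in C, [set u; w] \notin R]].
  by move/forall_inP; exists u.
apply: contraTT ltRA; rewrite negb_exists_in => /forall_inP touched.
rewrite -leqNgt; apply: leq_trans (cross_le_card R disjAC); rewrite -sum1_card.
apply: leq_sum => u /touched; rewrite negb_forall_in => /exists_inP[w wC].
rewrite negbK => uwR; rewrite card_gt0; apply/set0Pn; exists w.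
by rewrite inE wC.
Qed.

End Counting.

(** * Numerical estimates *)

Section Estimates.

Local Open Scope Z_scope.
Implicit Types n b x t : Z.

(** Here n vertices are split into classes of sizes x and x + t and z outer
    vertices. *)
Lemma final_estimate n b x t z :
  2000 <= n -> 0 <= b -> 29 * b <= 9 * n ->
  n <= 6 * (x + 1) -> 6 * x <= n -> 0 <= x -> 0 <= t <= b ->
  2 * x + t + z = n ->
  2 * b * (2 * x + t - 1) <
    2 * (x * (x - 1)) + (x + t) * (x + t - 1) + 2 * (z * (x - 1)).
Proof.
intros n_large b0 b_le x_ge x_le x0 t_bd sum_n.
replace z with (n - 2 * x - t) by lia.
pose proof (Z.square_nonneg (b - t)).
assert (0 <= (9 * n - 29 * b) * x) by (apply Z.mul_nonneg_nonneg; lia).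
assert (0 <= (n - 6 * x) * x) by (apply Z.mul_nonneg_nonneg; lia).
assert (0 <= (6 * (x + 1) - n) * n) by (apply Z.mul_nonneg_nonneg; lia).
assert (0 <= (9 * n - 29 * b) * (9 * n + 29 * b))
  by (apply Z.mul_nonneg_nonneg; lia).
assert (0 <= (n - 2000) * n) by (apply Z.mul_nonneg_nonneg; lia).
lia.
Qed.

(** The right-hand side is the difference of the two sides of [stuck_estimate]
    for q = b + 1, d = 0 and z = n - 2x - t. *)
Lemma stuck_estimate_few n b x t :
  2000 <= n -> 0 <= b -> 29 * b <= 9 * n ->
  1 <= x -> 6 * x <= n -> 0 <= t <= b ->
  0 < x * (2 * n - 4 * b - x - 3) + t * (2 * n - 4 * b - 4 * x - t - 3) + 2 * b.
Proof.
intros n_large b0 b_le x1 x_le t_bd.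
assert (0 <= (9 * n - 29 * b) * x) by (apply Z.mul_nonneg_nonneg; lia).
assert (0 <= (9 * n - 29 * b) * t) by (apply Z.mul_nonneg_nonneg; lia).
assert (0 <= (n - 6 * x) * x) by (apply Z.mul_nonneg_nonneg; lia).
assert (0 <= t * (b - t)) by (apply Z.mul_nonneg_nonneg; lia).
assert (0 <= (n - 2000) * x) by (apply Z.mul_nonneg_nonneg; lia).
assert (0 <= (n - 2000) * t) by (apply Z.mul_nonneg_nonneg; lia).
(* For 10 x <= n the factor of t is nonnegative; for larger x it may be
   negative, but then the first product dominates. *)
destruct (Z.le_gt_cases (10 * x) n).
- assert (0 <= (n - 10 * x) * t) by (apply Z.mul_nonneg_nonneg; lia).
  lia.
- assert (0 <= (9 * n - 29 * t) * (10 * x - n))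
    by (apply Z.mul_nonneg_nonneg; lia).
  assert (0 <= (n - 6 * x) * n) by (apply Z.mul_nonneg_nonneg; lia).
  assert (0 <= (n - 2000) * n) by (apply Z.mul_nonneg_nonneg; lia).
  lia.
Qed.

(** The left-hand side is minus four times the minimum over q of
    q^2 - (2t + b + 1)q, which is how q enters [stuck_estimate] when
    d = q(q - 1 - b). *)
Lemma stuck_estimate_many n b x t :
  2000 <= n -> 9 * n <= 29 * (b + 1) -> 29 * b <= 9 * n ->
  1 <= x -> 6 * x <= n -> b <= 2 * t -> t <= b ->
  (2 * t + b + 1) * (2 * t + b + 1) <
    4 * (2 * (x * (x - 1)) + (x + t) * (x + t - 1)
         + 2 * ((n - 2 * x - t) * (x + t)) - 2 * b * (2 * x + t - 1)).
Proof.
intros n_large b_ge b_le x1 x_le bt tb.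
assert (0 <= (9 * n - 29 * b) * x) by (apply Z.mul_nonneg_nonneg; lia).
assert (0 <= (9 * n - 29 * b) * t) by (apply Z.mul_nonneg_nonneg; lia).
assert (0 <= (n - 6 * x) * x) by (apply Z.mul_nonneg_nonneg; lia).
assert (0 <= (9 * n - 29 * b) * (9 * n + 29 * b))
  by (apply Z.mul_nonneg_nonneg; lia).
assert (0 <= (58 * t - 9 * n + 29) * (9 * n - 29 * t))
  by (apply Z.mul_nonneg_nonneg; lia).
assert (0 <= (n - 6 * x) * (58 * t - 9 * n + 29))
  by (apply Z.mul_nonneg_nonneg; lia).
assert (0 <= x * (9 * n - 29 * t)) by (apply Z.mul_nonneg_nonneg; lia).
assert (0 <= (n - 2000) * n) by (apply Z.mul_nonneg_nonneg; lia).
assert (0 <= (n - 6 * x) * n) by (apply Z.mul_nonneg_nonneg; lia).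
assert (0 <= (9 * n - 29 * t) * n) by (apply Z.mul_nonneg_nonneg; lia).
assert (0 <= (58 * t - 9 * n + 29) * n) by (apply Z.mul_nonneg_nonneg; lia).
lia.
Qed.

(** Here z outer vertices are full to a class, q of them to the smaller class
    of size x and the others to that of size x + t, and d counts twice the
    Breaker edges between outer vertices. *)
Lemma stuck_estimate n b x t z q d :
  2000 <= n -> 9 * n <= 29 * (b + 1) -> 29 * b <= 9 * n ->
  1 <= x -> 6 * x <= n -> 0 <= t <= b -> 0 <= d -> q * q <= q * (b + 1) + d ->
  2 * x + t + z = n ->
  2 * b * (2 * x + t - 1) <
    2 * (x * (x - 1)) + (x + t) * (x + t - 1)
    + 2 * (z * (x + t)) - 2 * q * t + d.
Proof.
intros n_large b_ge b_le x1 x_le t_bd d0 q_le sum_n.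
replace z with (n - 2 * x - t) by lia.
assert (b0 : 0 <= b) by lia.
pose proof (@stuck_estimate_few n b x t n_large b0 b_le x1 x_le t_bd).
destruct (Z.le_gt_cases q (b + 1)).
- assert (0 <= t * (b + 1 - q)) by (apply Z.mul_nonneg_nonneg; lia).
  lia.
- destruct (Z.le_gt_cases b (2 * t)).
  + assert (many := @stuck_estimate_many n b x t n_large b_ge b_le x1 x_le).
    pose proof (Z.square_nonneg (2 * q - (2 * t + b + 1))).
    assert (tb : t <= b) by lia.
    pose proof (many ltac:(lia) tb). lia.
  + assert (0 <= (q - b - 1) * (q - 2 * t))
      by (apply Z.mul_nonneg_nonneg; lia).
    lia.
Qed.

End Estimates.

(** Raising x by one raises x(x-1)/2, the required number of wasted edges, by
    x. *)
Lemma square_step x c d c' :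
  x * x <= c.*2 + x -> x <= d -> d + c <= c' -> x.+1 * x.+1 <= c'.*2 + x.+1.
Proof. lia. Qed.

(** In both contradictions m is the number of Breaker edges, w of them wasted
    between the classes and s of them between the classes and the outer
    vertices, of which there are z, respectively q + r. *)
Lemma final_contradiction n b x y z w s m :
  2000 <= n -> b = 9 * n %/ 29 -> x = n %/ 6 -> x <= y <= x + b ->
  x + y + z = n -> x * x <= w.*2 + x -> z * x <= s + z -> m + b <= b * (x + y) ->
  x * x + y * y + w.*2 + s.*2 <= m.*2 + x + y -> False.
Proof.
move=> n_large b_def x_def le_xy sum_n w_ge s_ge m_le bound.
have b_le : 29 * b <= 9 * n by lia.
have [x_le x_ge] : 6 * x <= n /\ n <= 6 * (x + 1) by lia.
have [t t_def] : exists t, y = x + t by exists (y - x); lia.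
clear b_def x_def; subst y.
have := @final_estimate (Z.of_nat n) (Z.of_nat b) (Z.of_nat x) (Z.of_nat t)
  (Z.of_nat z) ltac:(lia) ltac:(lia) ltac:(lia) ltac:(lia)
  ltac:(lia) ltac:(lia) ltac:(lia) ltac:(lia).
lia.
Qed.

Lemma stuck_contradiction n b x y q r w s d m :
  2000 <= n -> b = 9 * n %/ 29 -> 0 < x -> 6 * x <= n -> x <= y <= x + b ->
  x + y + (q + r) = n -> x * x <= w.*2 + x -> q * x + r * y <= s ->
  q * q <= q * (b + 1) + d -> m + b <= b * (x + y) ->
  x * x + y * y + w.*2 + s.*2 + d <= m.*2 + x + y -> False.
Proof.
move=> n_large b_def x0 x_le le_xy sum_n w_ge s_ge d_ge m_le bound.
have [b_le b_ge] : 29 * b <= 9 * n /\ 9 * n <= 29 * (b + 1) by lia.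
have [t t_def] : exists t, y = x + t by exists (y - x); lia.
clear b_def; subst y.
have := @stuck_estimate (Z.of_nat n) (Z.of_nat b) (Z.of_nat x) (Z.of_nat t)
  (Z.of_nat (q + r)) (Z.of_nat q) (Z.of_nat d) ltac:(lia) ltac:(lia) ltac:(lia) ltac:(lia) ltac:(lia)
  ltac:(lia) ltac:(lia) ltac:(lia) ltac:(lia).
lia.
Qed.

(** * Odd cycles and the tree of Maker *)

Section OddCycles.

Variable n : nat.
Implicit Types (M : {set {set 'I_n}}) (c : seq 'I_n).

Definition edge M : rel 'I_n := [rel u v | [set u; v] \in M].

Lemma cycle_edges_subset M c :
  cycle (edge M) c -> cycle_edges c \subset M.
Proof.
by move=> cycM; apply/subsetP=> _ /imsetP[u uc ->]; apply: next_cycle cycM uc.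
Qed.

Lemma odd_cycle_card_gt1 (A : {set {set 'I_n}}) : odd_cycle A -> 1 < #|A|.
Proof.
case=> c [uniq_c size_c _ ->]; case: c uniq_c size_c => [|x [|y [|z c]]] // uniq_c _.
have [xy yz] : [set x; y] \in cycle_edges [:: x, y, z & c] /\
               [set y; z] \in cycle_edges [:: x, y, z & c].
  split; apply/imsetP; [exists x|exists y]; rewrite ?inE ?eqxx ?orbT //=.
    by rewrite eqxx.
  by move: uniq_c; rewrite /= inE eqxx eq_sym => /andP[/norP[/negPf-> _] _].
rewrite (cardsD1 [set x; y]) xy ltnS card_gt0; apply/set0Pn.
exists [set y; z]; rewrite in_setD1 yz andbT; apply/eqP => eq_yz.
have : x \in [set y; z] by rewrite eq_yz set21.
move: uniq_c; rewrite /= !inE => /andP[/norP[/negPf-> /norP[/negPf-> _]] _].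
by [].
Qed.

End OddCycles.

Section MakerTree.

Variables (n b : nat).
Local Notation V := 'I_n.
Local Notation board := (complete_graph_edges n).
Variable P : {set {set V}} -> {set {set V}} -> Prop.
Hypothesis safeP : breaker_safe board (@odd_cycle n) b P.
Implicit Types (M B : {set {set V}}) (X Y : {set V}) (u v : V).

(** A safe position in which the edges of Maker form a connected bipartite
    graph with classes [X] and [Y], and Breaker owns no more edges than he can
    claim in |X| + |Y| - 1 turns.
    That the graph is acyclic is never used: it is only recorded that any two
    vertices are joined by a simple path, of odd length exactly when they lie
    in different classes. *)
Record maker_tree M B X Y : Prop := MakerTree {
  tree_safe : P M B;
  tree_edges : {in B, forall e : {set V}, #|e| = 2};
  tree_count : #|B| + b <= b * (#|X| + #|Y|);
  tree_claims : [disjoint M & B];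
  tree_sides : [disjoint X & Y];
  tree_cross : forall e, e \in M -> exists u v,
    [/\ u \in X, v \in Y & e = [set u; v]];
  tree_path : {in X :|: Y &, forall u v, exists p, [/\ path (edge M) u p,
    last u p = v, uniq (u :: p), {subset u :: p <= X :|: Y} &
    odd (size p) = (u \in X) (+) (v \in X)]} }.

Lemma maker_tree_sym M B X Y : maker_tree M B X Y -> maker_tree M B Y X.
Proof.
case=> PMB edges count claims sides crossM pathM.
split=> //; first by rewrite [#|Y| + _]addnC.
- by rewrite disjoint_sym.
- by move=> e /crossM[u [v [uX vY ->]]]; exists v, u; rewrite setUC.
move=> u v; rewrite setUC => uS vS; have [p [? ? ? ? oddp]] := pathM u v uS vS.
exists p; split=> //; rewrite oddp.
have flip w : w \in X :|: Y -> (w \in Y) = ~~ (w \in X).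
  rewrite inE; case: (boolP (w \in X)) => [wX _|_ //].
  by rewrite (disjointFr sides wX).
by rewrite !flip // addbN addNb negbK.
Qed.

(** Otherwise Maker closes an odd cycle at once. *)
Lemma tree_clique M B X Y : maker_tree M B X Y ->
  {in X &, forall u v, u != v -> [set u; v] \in B}.
Proof.
case=> PMB edges count claims sides crossM pathM u v uX vX neq_uv.
apply: contraT => uvB.
have uvM : [set u; v] \notin M.
  apply/negP => /crossM[x [y [xX yY eq_e]]].
  have : y \in [set u; v] by rewrite eq_e set22.
  by rewrite !inE => /orP[] /eqP y_eq; move: yY; rewrite y_eq (disjointFr sides).
have free : [set u; v] \in board :\: (M :|: B).
  by rewrite !inE negb_or uvM uvB cards2 neq_uv.
have [R _ PR] := safe_reply safeP PMB free.
have [uS vS] : u \in X :|: Y /\ v \in X :|: Y by rewrite !inE uX vX.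
have [p [pathp lastp uniqp _]] := pathM u v uS vS.
rewrite uX vX => evenp.
suff oddc : odd_cycle (cycle_edges (u :: p)).
  case/negP: (safe_avoids safeP PR oddc); apply: cycle_edges_subset.
  rewrite /= rcons_path lastp; apply/andP; split; last first.
    by rewrite /edge /= [[set v; u]]setUC setU11.
  by apply: sub_path pathp => x y; rewrite /edge /= => xyM; rewrite setU1r.
exists (u :: p); split=> //=; last by rewrite evenp.
case: p evenp lastp {pathp uniqp} => [|x [|y p]] //= _ eq_uv.
by rewrite eq_uv eqxx in neq_uv.
Qed.

(** Maker attaches the outer vertex [v] to [x], and Breaker answers with [R]. *)
Lemma tree_grow M B X Y x v : maker_tree M B X Y ->
  x \in X -> v \notin X :|: Y -> [set v; x] \notin B ->
  exists2 R : {set {set V}}, #|R| <= b &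
    maker_tree ([set v; x] |: M) (R :|: B) X (v |: Y).
Proof.
case=> PMB edges count claims sides crossM pathM xX vS vxB.
have [vX vY] : v \notin X /\ v \notin Y by apply/norP; rewrite -in_setU.
have neq_vx : v != x by apply: contraNneq vX => ->.
have vxM : [set v; x] \notin M.
  apply/negP => /crossM[u [w [uX wY eq_e]]].
  have : v \in [set u; w] by rewrite -eq_e set21.
  by rewrite !inE => /orP[] /eqP v_eq; move: vX vY; rewrite v_eq (uX, wY).
have free : [set v; x] \in board :\: (M :|: B).
  by rewrite !inE negb_or vxM vxB cards2 neq_vx.
have [R [sR cardR] PR] := safe_reply safeP PMB free.
have Rfree e : e \in R -> [/\ e != [set v; x], e \notin M & #|e| = 2].
  by move/(subsetP sR); rewrite !inE => /and3P[-> /norP[-> _] /eqP].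
have Rb : #|R| <= b by rewrite cardR geq_minl.
exists R => //; split=> //.
- by move=> e; rewrite inE => /orP[/Rfree[]|/edges].
- rewrite cardsU1 vY addnCA mulnDr muln1; apply: leq_trans (leq_add Rb count).
  by rewrite addnA leq_add2r cardsU leq_subr.
- rewrite disjoint_sym disjoints_subset; apply/subsetP=> e; rewrite !inE negb_or.
  case/orP=> [/Rfree[-> -> //]|eB]; rewrite (disjointFl claims eB) andbT.
  by apply: contraNneq vxB => <-.
- by rewrite -setI_eq0 setIUr setU_eq0 !setI_eq0 sides disjoint_sym disjoints1 vX.
- move=> e; rewrite !inE => /orP[/eqP->|/crossM[u [w [uX wY ->]]]].
    by exists x, v; rewrite setU11 setUC.
  by exists u, w; rewrite setU1r.
have edgeS : subrel (edge M) (edge ([set v; x] |: M)).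
  by move=> u w; rewrite /edge /= => uwM; rewrite setU1r.
have inS : {subset X :|: Y <= X :|: (v |: Y)}.
  by move=> u; rewrite !inE => /orP[]->; rewrite ?orbT.
have vS' : v \in X :|: (v |: Y) by rewrite !inE eqxx orbT.
have cases u : u \in X :|: (v |: Y) -> u = v \/ u \in X :|: Y.
  by rewrite !inE => /or3P[uX|/eqP|uY]; [right|left|right]; rewrite ?uX ?uY ?orbT.
have xS : x \in X :|: Y by rewrite inE xX.
move=> u w /cases[->|uS] /cases[->|wS].
- exists [::]; split=> //=; last by rewrite addbb.
  by move=> z; rewrite mem_seq1 => /eqP->.
- have [p [pathp lastp uniqp sp oddp]] := pathM x w xS wS.
  exists (x :: p); split=> //.
  + by rewrite /= {1}/edge /= setU11 (sub_path edgeS).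
  + by rewrite cons_uniq uniqp andbT; apply: contra vS => /sp.
  + by move=> z; rewrite inE => /predU1P[->|/sp/inS].
  by rewrite /= oddp xX (negPf vX) addTb addFb negbK.
- have [p [pathp lastp uniqp sp oddp]] := pathM u x uS xS.
  exists (rcons p v); split.
  + by rewrite rcons_path (sub_path edgeS) // lastp /edge /= [[set x; v]]setUC setU11.
  + by rewrite last_rcons.
  + rewrite -rcons_cons rcons_uniq uniqp andbT; apply: contra vS => /sp; exact.
  + move=> z; rewrite -rcons_cons mem_rcons inE => /predU1P[->|/sp/inS] //.
  by rewrite size_rcons /= oddp xX (negPf vX) addbT addbF negbK.
have [p [pathp lastp uniqp sp oddp]] := pathM u w uS wS.
exists p; split=> //; first exact: sub_path pathp.
by move=> z /sp/inS.
Qed.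

(** If Maker attached [v] to [x], Breaker would have one turn to complete the
    edges from [v] to [Y]. *)
Lemma tree_deg M B X Y x v : maker_tree M B X Y ->
  x \in X -> v \notin X :|: Y -> [set v; x] \notin B ->
  #|Y| <= deg B v Y + b.
Proof.
move=> treeM xX vS vxB; have [R Rb treeR] := tree_grow treeM xX vS vxB.
have clique := tree_clique (maker_tree_sym treeR).
have vY : v \notin Y by apply: contra vS; rewrite inE orbC => ->.
rewrite -(@deg_full _ (R :|: B) v Y).
  rewrite addnC; apply: leq_trans (degUl _ _ _ _) _.
  by rewrite leq_add2r (leq_trans (deg_le_card _ _ _)).
move=> u uY; apply: clique; rewrite ?setU11 ?setU1r //.
by apply: contraNneq vY => ->.
Qed.

End MakerTree.

(** * The strategy of Maker *)

Section MakerStrategy.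

Variables (n b : nat).
Local Notation V := 'I_n.
Local Notation board := (complete_graph_edges n).
Variable P : {set {set V}} -> {set {set V}} -> Prop.
Hypothesis safeP : breaker_safe board (@odd_cycle n) b P.
Hypotheses (n_large : 2000 <= n) (b_def : b = 9 * n %/ 29).
Implicit Types (M B : {set {set V}}) (X Y : {set V}) (u v : V).

(** The invariant of the strategy: [Y] exceeds [X] by at most [b]; Breaker
    has wasted |X|(|X|-1)/2 edges between them; and either |Y| is within 1 of
    |X| + b, or every outer vertex has |X| - 1 Breaker edges to the tree.  In
    the first case the latter bound follows from [tree_deg]. *)
Record rest_state M B X Y : Prop := RestState {
  rest_tree : maker_tree b P M B X Y;
  rest_pos : 0 < #|X|;
  rest_balance : #|X| <= #|Y| <= #|X| + b;
  rest_waste : #|X| * #|X| <= (cross B X Y).*2 + #|X|;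
  rest_outer : #|X| + b <= #|Y| + 1 \/
    {in ~: (X :|: Y), forall v, #|X| <= deg B v X + deg B v Y + 1} }.

Lemma rest_start : exists M B X Y, rest_state M B X Y /\ #|X| = 1.
Proof.
have n0 : 0 < n by lia.
have n1 : 1 < n by lia.
pose x : V := Ordinal n0; pose y : V := Ordinal n1.
(* The tree on the single vertex x is a valid start; its first edge is xy. *)
have tree0 : maker_tree b P set0 set0 [set x] set0.
  split=> [|e||||e|u v].
  - by case: safeP.
  - by rewrite inE.
  - by rewrite !cards0 cards1 add0n addn0 muln1.
  - by rewrite -setI_eq0 set0I.
  - by rewrite -setI_eq0 setI0 eqxx.
  - by rewrite inE.
  rewrite setU0 !inE => /eqP-> /eqP->; exists [::]; split=> //= z.
  by rewrite mem_seq1 inE.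
have [||| R _ tree1] := @tree_grow n b P safeP _ _ _ _ x y tree0.
- by rewrite inE.
- by rewrite setU0 inE.
- by rewrite inE.
exists ([set y; x] |: set0), (R :|: set0), [set x], (y |: set0).
split; last by rewrite cards1.
have cardX : #|[set x]| = 1 by rewrite cards1.
have cardY : #|y |: set0| = 1 by rewrite setU0 cards1.
split; rewrite ?cardX ?cardY //; first by rewrite leq_addl.
by right=> v _; rewrite addn1.
Qed.

(** With |Y| < |X| + b, an outer vertex not full to [X] goes to [Y]. *)
Lemma rest_step_Y M B X Y v : rest_state M B X Y ->
  v \notin X :|: Y -> ~~ full B v X -> #|Y| < #|X| + b ->
  exists M' B', rest_state M' B' X (v |: Y).
Proof.
case=> treeM pos balance waste outer vS /fullPn[x xX vxB] ltY.
have [R _ treeR] := tree_grow safeP treeM xX vS vxB.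
exists ([set v; x] |: M), (R :|: B).
have vY : v \notin Y by apply: contra vS; rewrite inE orbC => ->.
have cardY : #|v |: Y| = #|Y|.+1 by rewrite cardsU1 vY.
split=> //; rewrite ?cardY.
- by lia.
- have := crossS X (subsetUr R B) (subsetUr [set v] Y); lia.
case: outer => [le_Y|outer]; [left; lia|right=> u].
rewrite !inE !negb_or => /and3P[uX _ uY].
have /outer : u \in ~: (X :|: Y) by rewrite !inE negb_or uX.
have := degS u (subsetUr R B) (subxx X).
have := degS u (subsetUr R B) (subsetUr [set v] Y); lia.
Qed.

(** With |Y| = |X| + b, an outer vertex full to neither class goes to [X].  It
    has at least |Y| - b = |X| Breaker edges to [Y], which are wasted. *)
Lemma rest_step_X M B X Y v : rest_state M B X Y ->
  v \notin X :|: Y -> ~~ full B v X -> ~~ full B v Y -> #|Y| = #|X| + b ->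
  exists M' B', rest_state M' B' (v |: X) Y.
Proof.
case=> treeM pos balance waste outer vS /fullPn[x xX vxB] /fullPn[y yY vyB] eqY.
have degv := tree_deg safeP treeM xX vS vxB.
have vS' : v \notin Y :|: X by rewrite setUC.
have [R _ treeR] := tree_grow safeP (maker_tree_sym treeM) yY vS' vyB.
exists ([set v; y] |: M), (R :|: B).
have vX : v \notin X by apply: contra vS; rewrite inE => ->.
have cardX : #|v |: X| = #|X|.+1 by rewrite cardsU1 vX.
split=> //; rewrite ?cardX //.
- exact: maker_tree_sym.
- by lia.
- apply: (@square_step _ _ (deg B v Y) _ waste).
    by rewrite -(leq_add2r b) -eqY.
  by rewrite crossU1l // leq_add ?degS ?crossS ?subsetUr.
by left; lia.
Qed.

(** Two turns when each outer vertex is full to a class: [v] goes to [X], and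
    then a vertex [u], full to [X] beforehand, is attached to [v] and goes to
    [Y], wasting its |X| Breaker edges to [X]. *)
Lemma rest_step_XY M B X Y v : rest_state M B X Y ->
  {in ~: (X :|: Y), forall u, full B u X || full B u Y} ->
  v \notin X :|: Y -> ~~ full B v Y ->
  b + deg B v [set u in ~: (X :|: Y) | ~~ full B u Y] + 1 <
    #|[set u in ~: (X :|: Y) | ~~ full B u Y]| ->
  exists M' B' u, rest_state M' B' (v |: X) (u |: Y).
Proof.
set Z1 := [set u in _ | _].
case=> treeM pos balance waste outer allfull vS vYfree ltZ1.
have /fullPn[y yY vyB] := vYfree.
have vS' : v \notin Y :|: X by rewrite setUC.
have [vX vY] : v \notin X /\ v \notin Y by apply/norP; rewrite -in_setU.
have [R Rb treeR] := tree_grow safeP (maker_tree_sym treeM) yY vS' vyB.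
(* Breaker touches fewer than |N| vertices of N by edges to Y and v. *)
pose N := [set u in Z1 :\ v | [set v; u] \notin B].
have ltRN : #|R| < #|N|.
  have vZ1 : v \in Z1 by rewrite !inE negb_or vX vY.
  have cardZ1 : #|Z1| <= deg B v Z1 + #|N| + 1.
    rewrite (cardsD1 v) vZ1 addnC leq_add2r /deg.
    rewrite -(cardsID [set u | [set v; u] \in B] (Z1 :\ v)).
    apply: leq_add; apply: subset_leq_card; apply/subsetP=> u; rewrite !inE.
      by case/andP=> /andP[_ ->] ->.
    by case/andP=> -> /andP[-> ->].
  by lia.
have NE u : u \in N -> [/\ u != v, u \notin X, u \notin Y,
    [set u; v] \notin B & full B u X /\ ~~ full B u Y].
  rewrite !inE !negb_or -!andbA => /and5P[uv uX uY uYfree uvB].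
  split=> //; first by rewrite setUC.
  by have := allfull u; rewrite !inE negb_or uX uY (negPf uYfree) orbF => ->.
have [|u uN untouched] := @untouched_vertex _ R N (v |: Y) _ ltRN.
  rewrite disjoint_subset; apply/subsetP=> u /NE[uv _ uY _ _].
  by rewrite !inE negb_or uv.
have [uv uX uY uvB [uXfull uYfree]] := NE u uN.
have uv' : [set u; v] \notin R :|: B.
  by rewrite inE negb_or uvB untouched ?setU11.
have uS : u \notin (v |: X) :|: Y by rewrite !inE !negb_or uv uX uY.
have [R' _ treeR'] :=
  tree_grow safeP (maker_tree_sym treeR) (setU11 v X) uS uv'.
set M' := _ |: (_ |: M) in treeR'; set B' := R' :|: _ in treeR'.
have sB : B \subset B' by rewrite /B' setUA subsetUr.
have uX' : u \notin v |: X by rewrite !inE negb_or uv.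
exists M', B', u.
have cardX : #|v |: X| = #|X|.+1 by rewrite cardsU1 vX.
have cardY : #|u |: Y| = #|Y|.+1 by rewrite cardsU1 uY.
split=> //; rewrite ?cardX ?cardY //.
- apply: (@square_step _ _ (deg B u X) _ waste).
    by rewrite deg_of_full.
  rewrite crossU1r // leq_add //; first by rewrite degS ?subsetUr.
  by rewrite crossU1l // (leq_trans (crossS X sB (subxx Y))) ?leq_addl.
(* Before the two turns w was full to a class, and both had at least |X|
   vertices. *)
right=> w; rewrite !inE !negb_or => /andP[/andP[_ wX] /andP[_ wY]].
have := allfull w; rewrite !inE negb_or wX wY addn1 ltnS => /(_ isT) /orP[] fullw.
  by rewrite -(deg_of_full fullw) (leq_trans _ (leq_addr _ _)) // degS ?subsetUr.
have /andP[leXY _] := balance; apply: leq_trans leXY _.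
by rewrite -(deg_of_full fullw) (leq_trans _ (leq_addl _ _)) // degS ?subsetUr.
Qed.

(** The hypothesis of [rest_step_XY] on [v] is met: otherwise Breaker owns too
    many edges inside [Z1]. *)
Lemma rest_not_stuck M B X Y (Z := ~: (X :|: Y))
    (Z1 := [set u in Z | ~~ full B u Y]) :
  rest_state M B X Y -> 6 * #|X| <= n ->
  {in Z, forall u, full B u X || full B u Y} ->
  exists2 v, v \in Z1 & b + deg B v Z1 + 1 < #|Z1|.
Proof.
case=> treeM pos balance waste _ le_X allfull; apply/exists_inP; apply: contraT.
rewrite negb_exists_in => /forall_inP stuck; exfalso.
pose Z3 := [set u in Z | full B u Y].
have cardZ : #|X| + #|Y| + (#|Z1| + #|Z3|) = n.
  apply: etrans (etrans _ (card_sides (tree_sides treeM))) (card_ord n).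
  congr (_ + _); rewrite -/Z.
  rewrite -(cardsID Z3 Z) addnC; congr (_ + _); apply: eq_card => u; rewrite !inE.
    by do !case: (_ \in _); case: (full _ _ _).
  by do !case: (_ \in _); case: (full _ _ _).
have bound := card_lower_bound (tree_edges treeM) (tree_sides treeM)
  (tree_clique safeP treeM) (tree_clique safeP (maker_tree_sym treeM)).
apply: stuck_contradiction n_large b_def pos le_X balance cardZ waste _ _
  (tree_count treeM) bound.
  rewrite -/Z (bigID (fun u => full B u Y)) /= [leqRHS]addnC -!sum_nat_const.
  apply: leq_add.
    rewrite big_mkcond [leqRHS]big_mkcond; apply: leq_sum => u _.
    rewrite /Z1 inE; case: ifP => // /andP[uZ uY].
    have := allfull u uZ; rewrite (negPf uY) orbF => /deg_of_full->.
    exact: leq_addr.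
  rewrite big_mkcond [leqRHS]big_mkcond; apply: leq_sum => u _.
  rewrite /Z3 inE; case: ifP => // /andP[uZ uY].
  by rewrite (deg_of_full uY) leq_addl.
apply: (@leq_trans (#|Z1| * (b + 1) + cross B Z1 Z)).
  rewrite -!sum_nat_const /cross -big_split; apply: leq_sum => u uZ1.
  apply: leq_trans (_ : b + deg B u Z1 + 1 <= _).
    by rewrite leqNgt stuck.
  rewrite addnAC leq_add2l degS //; apply/subsetP=> w; rewrite inE.
  by case/andP.
rewrite leq_add2l; rewrite /cross [leqRHS](bigID (fun u => ~~ full B u Y)) /=.
rewrite -[leqLHS]addn0 leq_add // big_mkcond [leqRHS]big_mkcond.
by apply: leq_sum => u _; rewrite /Z1 inE; case: ifP.
Qed.

Lemma rest_final M B X Y : rest_state M B X Y -> #|X| = n %/ 6 -> False.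
Proof.
case=> treeM pos balance waste outer cardX.
have cardZ : #|X| + #|Y| + #|~: (X :|: Y)| = n.
  exact: etrans (card_sides (tree_sides treeM)) (card_ord n).
have bound := card_lower_bound (tree_edges treeM) (tree_sides treeM)
  (tree_clique safeP treeM) (tree_clique safeP (maker_tree_sym treeM)).
apply: final_contradiction n_large b_def cardX balance cardZ waste _
  (tree_count treeM) (leq_trans (leq_addr _ _) bound).
rewrite -sum_nat_const -[#|~: _| in leqRHS]sum1_card -big_split; apply: leq_sum => u uZ /=.
case: outer => [leY|]; last exact.
have [uX|/fullPn[x xX uxB]] := boolP (full B u X).
  by rewrite (deg_of_full uX) -addnA leq_addr.
have uS : u \notin X :|: Y by rewrite -in_setC.
have := tree_deg safeP treeM xX uS uxB.
move: leY; move: #|X| #|Y| (deg B u X) (deg B u Y) => *; lia.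
Qed.

Lemma rest_card_le M B X Y : rest_state M B X Y -> #|X| + #|Y| <= n.
Proof.
case=> treeM _ _ _ _.
apply: leq_trans (_ : #|X| + #|Y| + #|~: (X :|: Y)| <= _); first exact: leq_addr.
by rewrite (card_sides (tree_sides treeM)) card_ord.
Qed.

Lemma no_rest_state M B X Y : rest_state M B X Y -> #|X| <= n %/ 6 -> False.
Proof.
have [k] := ubnP (n - (#|X| + #|Y|)).
(* Induction on the number of outer vertices. *)
elim: k M B X Y => // k IHk M B X Y le_k rest leX.
move: (leX); rewrite leq_eqVlt => /predU1P[/(rest_final rest) //|ltX].
have le6X : 6 * #|X| <= n by move: leX; move: #|X| => *; lia.
have measure M' B' X' Y' : rest_state M' B' X' Y' ->
    #|X| + #|Y| < #|X'| + #|Y'| -> n - (#|X'| + #|Y'|) < k.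
  by move=> /rest_card_le; move: #|X| #|Y| #|X'| #|Y'| le_k => *; lia.
pose Z := ~: (X :|: Y); have /andP[_ leY] := rest_balance rest.
have [/exists_inP[v vZ]|] := boolP [exists v in Z, ~~ full B v X && ~~ full B v Y].
  case/andP=> vXfree vYfree; have vS : v \notin X :|: Y by rewrite -in_setC.
  have [vX vY] : v \notin X /\ v \notin Y by apply/norP; rewrite -in_setU.
  move: leY; rewrite leq_eqVlt => /predU1P[eqY|ltY].
    have [M' [B' rest']] := rest_step_X rest vS vXfree vYfree eqY.
    have cardX' : #|v |: X| = #|X|.+1 by rewrite cardsU1 vX.
    apply: (IHk _ _ _ _ _ rest'); last by rewrite cardX'.
    by rewrite (measure _ _ _ _ rest') // cardX'.
  have [M' [B' rest']] := rest_step_Y rest vS vXfree ltY.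
  have cardY' : #|v |: Y| = #|Y|.+1 by rewrite cardsU1 vY.
  apply: (IHk _ _ _ _ _ rest' leX).
  by rewrite (measure _ _ _ _ rest') // cardY' addnS.
rewrite negb_exists_in => /forall_inP nofree.
have allfull : {in Z, forall u, full B u X || full B u Y}.
  by move=> u /nofree; rewrite negb_and !negbK.
have [v] := rest_not_stuck rest le6X allfull.
rewrite inE => /andP[vZ vYfree] ltZ1.
have vS : v \notin X :|: Y by rewrite -in_setC.
have vX : v \notin X by apply: contra vS; rewrite inE => ->.
have [M' [B' [u rest']]] := rest_step_XY rest allfull vS vYfree ltZ1.
have cardX' : #|v |: X| = #|X|.+1 by rewrite cardsU1 vX.
apply: (IHk _ _ _ _ _ rest'); last by rewrite cardX'.
rewrite (measure _ _ _ _ rest') // cardX' addSn ltnS leq_add2l.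
exact: subset_leq_card (subsetUr _ _).
Qed.

Lemma no_safe_family : False.
Proof.
have [M [B [X [Y [rest cardX]]]]] := rest_start.
by apply: no_rest_state rest _; rewrite cardX; lia.
Qed.

End MakerStrategy.

(** * The threshold bias *)

Lemma not_breaker_wins_odd_cycle n : 2000 <= n ->
  ~ breaker_wins (complete_graph_edges n) (@odd_cycle n) (9 * n %/ 29).
Proof.
move=> n_large /breaker_winsP[P safeP].
exact: no_safe_family safeP n_large erefl.
Qed.

Lemma b_mb_odd_cycle_lower_bound n : 2000 <= n -> 9 * n < 29 * b_mb_odd_cycle n.
Proof.
move=> n_large.
have := lt_threshold_bias (@odd_cycle_card_gt1 n)
  (not_breaker_wins_odd_cycle n_large).
rewrite -/(b_mb_odd_cycle n); move: (b_mb_odd_cycle n) => t.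
by rewrite ltn_divLR // [29 * t]mulnC.
Qed.

From mathcomp Require Import all_classical all_reals all_analysis.

Import Order.TTheory GRing.Theory Num.Theory.
Import numFieldNormedType.Exports.
Local Open Scope classical_set_scope.
Local Open Scope ring_scope.

Lemma odd_cycle_constant_le (R : realType) :
  (4 - Num.sqrt 6) / 5 <= 9 / 29 :> R.
Proof.
(* (71/29)^2 = 5041/841 < 6. *)
have : 71 / 29 <= Num.sqrt 6 :> R.
  rewrite -(@ger0_norm R (71 / 29)); last by lra.
  by rewrite -sqrtr_sqr ler_wsqrtr // expr2; lra.
lra.
Qed.

Theorem theorem1p1 (R : realType) :
  exists2 delta : nat -> R,
    delta n @[n --> \oo] --> (0 : R) &
    forall n : nat,
      ((4 - Num.sqrt 6) / 5 - delta n) * n%:R <= (b_mb_odd_cycle n)%:R.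
Proof.
have le_c := odd_cycle_constant_le R.
exists (fun n => if (2000 <= n)%N then 0 else 1).
  by apply: cvg_near_cst; exists 2000%N => // n /= ->.
move=> n; case: ifPn => [n_large|_]; last first.
  apply: (@le_trans _ _ 0); last exact: ler0n.
  by rewrite mulr_le0_ge0 ?ler0n //; lra.
rewrite subr0; apply: (@le_trans _ _ (9 / 29 * n%:R)).
  exact: ler_wpM2r (ler0n _ _) _ _ le_c.
have := b_mb_odd_cycle_lower_bound n_large.
move/ltnW; rewrite -(ler_nat R) !natrM; lra.
Qed.
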